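(* Let $f$ be a meromorphic function defined on $\mathbb{C}$ that takes on real values, with possibly poles, along the real line (i.e. $f(x) \in \mathbb{R}$ for every $x \in \mathbb{R}$ that is not a pole of $f$). Then $f(\bar z) = \overline{f(z)}$ for all $z \in \mathbb{C}$ for which $f$ is defined. *)

(* Defs.v *)
From Stdlib Require Import Reals.
From Coquelicot Require Import Coquelicot.

(* Complex differentiability: the scalar field is C. *)
Definition C_differentiable (f : C -> C) (z : C) : Prop :=
  ex_derive (K := C_AbsRing) (V := C_NormedModule) f z.

(* [locally' p] is the filter of punctured neighbourhoods of [p], so [f p]
   itself is irrelevant in the next two definitions. *)
Definition isolated_singularity (f : C -> C) (p : C) : Prop :=
  locally' p (C_differentiable f).

Definition pole (f : C -> C) (p : C) : Prop :=
  isolated_singularity f p /\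
  filterlim (fun z : C => Cmod (f z)) (locally' p) (Rbar_locally p_infty).

(* A meromorphic function on C is a partial function, defined off its set of
   poles [P].  It is encoded by a total [f] whose values on [P] are
   meaningless: no clause below depends on them, because the complement of
   [P] is open by [mero_discrete]. *)
Record meromorphic (f : C -> C) (P : C -> Prop) : Prop := {
  (* no accumulation point in C, i.e. [P] is closed and discrete *)
  mero_discrete : forall z : C, locally' z (fun w : C => ~ P w);
  mero_holomorphic : forall z : C, ~ P z -> C_differentiable f z;
  mero_pole : forall p : C, P p -> pole f p
}.

(* Main.v *)
(** The function [h z = f z - conj (f (conj z))] vanishes on the real line, so
    gluing it (upper half plane) with [0] (lower half plane) gives a function
    holomorphic off a discrete set; it has to vanish.  Zeros propagate from a
    disc to a slightly larger one: turning by quarter turns about a point [a]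
    just outside, the product of the four rotated copies vanishes on a circle
    about [a], and its mean over concentric circles is constant by Goursat's
    theorem for rectangles, applied to [w |-> G (exp w)].  No power series are
    needed.  Finally [f] and its reflection agree off the poles, so a pole at
    [conj z] would make [f] unbounded near [z]. *)

Require Import Defs.
From Stdlib Require Import Reals Lra Lia List Classical IndefiniteDescription.
From Coquelicot Require Import Coquelicot.

(** * Goursat's theorem on rectangles for closed forms *)

(** Closedness of [p dx + q dy] in Goursat's pointwise form, which is what complex differentiability
    supplies; the shared [b] is the equality of the cross partials. *)
Definition closed_form_at (p q : R -> R -> R) (x y : R) : Prop :=
  exists a b c : R,
    differentiable_pt_lim p x y a b /\ differentiable_pt_lim q x y b c.

(** The counterclockwise integral of [p dx + q dy] around a rectangle. *)
Definition boundary_integral (p q : R -> R -> R) (x x' y y' : R) : R :=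
  RInt (fun t => p t y) x x' + RInt (fun t => q x' t) y y'
  - RInt (fun t => p t y') x x' - RInt (fun t => q x t) y y'.

Lemma differentiable_pt_lim_continuous (f : R -> R -> R) (x y a b : R) :
  differentiable_pt_lim f x y a b ->
  continuous (fun t => f t y) x /\ continuous (f x) y.
Proof.
intros H.
assert (D1 : derivable_pt_lim (fun t => f t y) x (a * 1 + b * 0)).
{ apply (derivable_pt_lim_comp_2d f (fun t => t) (fun _ => y)); trivial.
  - apply derivable_pt_lim_id.
  - apply derivable_pt_lim_const. }
assert (D2 : derivable_pt_lim (fun t => f x t) y (a * 0 + b * 1)).
{ apply (derivable_pt_lim_comp_2d f (fun _ => x) (fun t => t)); trivial.
  - apply derivable_pt_lim_const.
  - apply derivable_pt_lim_id. }
apply is_derive_Reals in D1. apply is_derive_Reals in D2.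
split; apply @ex_derive_continuous; eexists; [exact D1 | exact D2].
Qed.

Lemma ex_RInt_edges (p q : R -> R -> R) (a b c d : R)
  (Hcl : forall x y, a <= x <= b -> c <= y <= d -> closed_form_at p q x y) :
  (forall x x' y, a <= x <= x' -> x' <= b -> c <= y <= d ->
     ex_RInt (fun t => p t y) x x') /\
  (forall x y y', a <= x <= b -> c <= y <= y' -> y' <= d ->
     ex_RInt (q x) y y').
Proof.
split; intros.
- apply @ex_RInt_continuous; intros t Ht.
  rewrite Rmin_left, Rmax_right in Ht by lra.
  destruct (Hcl t y) as (? & ? & ? & Hp & Hq); [lra | lra |].
  exact (proj1 (differentiable_pt_lim_continuous _ _ _ _ _ Hp)).
- apply @ex_RInt_continuous; intros t Ht.
  rewrite Rmin_left, Rmax_right in Ht by lra.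
  destruct (Hcl x t) as (? & ? & ? & Hp & Hq); [lra | lra |].
  exact (proj2 (differentiable_pt_lim_continuous _ _ _ _ _ Hq)).
Qed.

(** Each inner edge is run through twice, in opposite directions, and cancels. *)
Lemma boundary_integral_split (p q : R -> R -> R) (a b c d : R)
  (Hcl : forall x y, a <= x <= b -> c <= y <= d -> closed_form_at p q x y)
  (x x1 x' y y1 y' : R) :
  a <= x <= x1 -> x1 <= x' <= b -> c <= y <= y1 -> y1 <= y' <= d ->
  boundary_integral p q x x' y y' =
    boundary_integral p q x x1 y y1 + boundary_integral p q x1 x' y y1
    + boundary_integral p q x x1 y1 y' + boundary_integral p q x1 x' y1 y'.
Proof.
intros.
destruct (ex_RInt_edges p q a b c d Hcl) as [Ep Eq].
assert (Hp : forall t, c <= t <= d -> RInt (fun s => p s t) x x' =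
   RInt (fun s => p s t) x x1 + RInt (fun s => p s t) x1 x').
{ intros t Ht. symmetry. apply (RInt_Chasles (fun s => p s t)); apply Ep; lra. }
assert (Hq : forall s, a <= s <= b -> RInt (q s) y y' =
   RInt (q s) y y1 + RInt (q s) y1 y').
{ intros t Ht. symmetry. apply (RInt_Chasles (q t)); apply Eq; lra. }
unfold boundary_integral.
change (fun t => q x t) with (q x). change (fun t => q x' t) with (q x').
change (fun t => q x1 t) with (q x1).
rewrite (Hp y), (Hp y'), (Hq x), (Hq x') by lra. ring.
Qed.

(** Serves to compare two opposite edges; [k] is the constant by which the affine approximations on
    them differ. *)
Lemma RInt_diff_le (f g : R -> R) (x x' k e : R) :
  x <= x' -> ex_RInt f x x' -> ex_RInt g x x' ->
  (forall t, x <= t <= x' -> Rabs (f t - g t - k) <= e) ->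
  Rabs (RInt f x x' - RInt g x x' - k * (x' - x)) <= (x' - x) * e.
Proof.
intros Hx Hf Hg H.
assert (Hfg : ex_RInt (fun t => minus (f t) (g t)) x x') by (apply @ex_RInt_minus; assumption).
assert (Hk : ex_RInt (fun _ => k) x x') by apply ex_RInt_const.
replace (RInt f x x' - RInt g x x' - k * (x' - x))
  with (RInt (fun t => minus (minus (f t) (g t)) k) x x').
- apply abs_RInt_le_const; [assumption | | exact H].
  apply @ex_RInt_minus; assumption.
- rewrite (RInt_minus (fun t => minus (f t) (g t)) (fun _ => k)) by assumption.
  rewrite (RInt_minus f g) by assumption.
  rewrite RInt_const. unfold minus, plus, opp, scal; simpl. unfold mult; simpl. ring.
Qed.

(* On a rectangle of diameter [l] the form is affine up to [e * l], and the
   boundary integral of an affine closed form is zero. *)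
Lemma boundary_integral_local (p q : R -> R -> R) (a b c d : R)
  (Hcl : forall x y, a <= x <= b -> c <= y <= d -> closed_form_at p q x y)
  (x0 y0 : R) (Hx0 : a <= x0 <= b) (Hy0 : c <= y0 <= d) (e : R) (He : 0 < e) :
  exists delta : R, 0 < delta /\ forall x x' y y' l,
    a <= x <= x0 -> x0 <= x' <= b -> c <= y <= y0 -> y0 <= y' <= d ->
    x' - x <= l -> y' - y <= l -> l < delta ->
    Rabs (boundary_integral p q x x' y y') <= e * l ^ 2.
Proof.
destruct (ex_RInt_edges p q a b c d Hcl) as [Ep Eq].
destruct (Hcl x0 y0 Hx0 Hy0) as (A & B & G & Hp & Hq).
(* Each of the four edges contributes an error of at most [e / 4 * l] over a length of at most
   [l]. *)
assert (He' : 0 < e / 4) by lra.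
destruct (Hp (mkposreal _ He')) as [d1 H1].
destruct (Hq (mkposreal _ He')) as [d2 H2].
exists (Rmin d1 d2). split. { apply Rmin_pos; apply cond_pos. }
intros x x' y y' l Hx Hx' Hy Hy' Hlx Hly Hl.
assert (Hl1 : l < d1) by (eapply Rlt_le_trans; [exact Hl | apply Rmin_l]).
assert (Hl2 : l < d2) by (eapply Rlt_le_trans; [exact Hl | apply Rmin_r]).
simpl in H1, H2.
assert (Habs : forall s t, x <= s <= x' -> y <= t <= y' ->
  Rabs (s - x0) <= l /\ Rabs (t - y0) <= l).
{ intros s t Hs Ht. split; apply Rabs_le; lra. }
assert (Bp : forall s t, x <= s <= x' -> y <= t <= y' ->
  Rabs (p s t - p x0 y0 - (A * (s - x0) + B * (t - y0))) <= e / 4 * l).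
{ intros s t Hs Ht. destruct (Habs s t Hs Ht).
  eapply Rle_trans; [apply H1; lra |].
  apply Rmult_le_compat_l; [lra |]. apply Rmax_lub; lra. }
assert (Bq : forall s t, x <= s <= x' -> y <= t <= y' ->
  Rabs (q s t - q x0 y0 - (B * (s - x0) + G * (t - y0))) <= e / 4 * l).
{ intros s t Hs Ht. destruct (Habs s t Hs Ht).
  eapply Rle_trans; [apply H2; lra |].
  apply Rmult_le_compat_l; [lra |]. apply Rmax_lub; lra. }
(* The affine parts differ by the constant [B * (y - y')] here and by [B * (x' - x)] on the vertical
   edges. Once integrated they cancel, because [B] is the same in both. *)
assert (Ip : Rabs (RInt (fun t => p t y) x x' - RInt (fun t => p t y') x x'
    - B * (y - y') * (x' - x)) <= (x' - x) * (e / 2 * l)).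
{ apply RInt_diff_le; [lra | apply Ep; lra | apply Ep; lra |].
  intros t Ht.
  assert (C1 := Bp t y ltac:(lra) ltac:(lra)). assert (C2 := Bp t y' ltac:(lra) ltac:(lra)).
  apply Rabs_le_between in C1. apply Rabs_le_between in C2. apply Rabs_le. lra. }
assert (Iq : Rabs (RInt (q x') y y' - RInt (q x) y y'
    - B * (x' - x) * (y' - y)) <= (y' - y) * (e / 2 * l)).
{ apply RInt_diff_le; [lra | apply Eq; lra | apply Eq; lra |].
  intros t Ht.
  assert (C1 := Bq x t ltac:(lra) ltac:(lra)). assert (C2 := Bq x' t ltac:(lra) ltac:(lra)).
  apply Rabs_le_between in C1. apply Rabs_le_between in C2. apply Rabs_le. lra. }
unfold boundary_integral.
change (fun t => q x t) with (q x). change (fun t => q x' t) with (q x').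
assert (Hl0 : 0 <= e / 2 * l) by nra.
assert (M1 := Rmult_le_compat_r _ _ _ Hl0 Hlx).
assert (M2 := Rmult_le_compat_r _ _ _ Hl0 Hly).
apply Rabs_le_between in Ip. apply Rabs_le_between in Iq. apply Rabs_le.
replace (e * l ^ 2) with (l * (e / 2 * l) + l * (e / 2 * l)) by field.
lra.
Qed.

(** The point is the supremum of the left ends, since every right end bounds every left end. *)
Lemma nested_intervals (u w : nat -> R) :
  (forall n, u n <= u (S n)) -> (forall n, u (S n) + w (S n) <= u n + w n) ->
  (forall n, 0 <= w n) -> exists x, forall n, u n <= x <= u n + w n.
Proof.
intros Hu Hw H0.
assert (Mu : forall n k, u n <= u (n + k)%nat).
{ intros n k; induction k as [|k IH]; [rewrite Nat.add_0_r; lra |].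
  rewrite Nat.add_succ_r. specialize (Hu (n + k)%nat). lra. }
assert (Mw : forall n k, u (n + k)%nat + w (n + k)%nat <= u n + w n).
{ intros n k; induction k as [|k IH]; [rewrite Nat.add_0_r; lra |].
  rewrite Nat.add_succ_r. specialize (Hw (n + k)%nat). lra. }
assert (M : forall m n, u m <= u n + w n).
{ intros m n. destruct (Nat.le_ge_cases m n) as [L|L].
  - replace n with (m + (n - m))%nat by lia.
    specialize (Mu m (n - m)%nat). specialize (H0 (m + (n - m))%nat). lra.
  - replace m with (n + (m - n))%nat by lia.
    specialize (Mw n (m - n)%nat). specialize (H0 (n + (m - n))%nat). lra. }
destruct (completeness (fun r => exists n, r = u n)) as [x [Ub Lub]].
- exists (u 0%nat + w 0%nat). intros r [n ->]. apply M.
- exists (u 0%nat), 0%nat. reflexivity.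
- exists x. intros n. split.
  + apply Ub. now exists n.
  + apply Lub. intros r [m ->]. apply M.
Qed.

Lemma dependent_choice (T : Type) (Q : nat -> T -> Prop) (E : nat -> T -> T -> Prop) (x0 : T) :
  Q O x0 -> (forall n x, Q n x -> exists y, Q (S n) y /\ E n x y) ->
  exists u : nat -> T, u O = x0 /\ forall n, Q n (u n) /\ E n (u n) (u (S n)).
Proof.
intros H0 HS.
(* Guarding the conclusion by [Q] makes the relation total, as [functional_choice] demands. *)
destruct (functional_choice (A := nat * T) (B := T)
  (fun a y => Q (fst a) (snd a) -> Q (S (fst a)) y /\ E (fst a) (snd a) y)) as [F HF].
{ intros [n x]. destruct (classic (Q n x)) as [H|H].
  - destruct (HS n x H) as [y Hy]. now exists y.
  - now exists x. }
pose (u := fix u n := match n with O => x0 | S m => F (m, u m) end).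
assert (Hu : forall n, Q n (u n)).
{ induction n as [|n IH]; [exact H0 |]. exact (proj1 (HF (n, u n) IH)). }
exists u. split; [reflexivity |]. intros n. split; [apply Hu |].
exact (proj2 (HF (n, u n) (Hu n))).
Qed.

(* Goursat's bisection: nested quarters, each carrying at least a quarter of
   the boundary integral, shrink to a point where [boundary_integral_local]
   is violated. *)
Theorem boundary_integral_closed (p q : R -> R -> R) (a b c d : R)
  (Hcl : forall x y, a <= x <= b -> c <= y <= d -> closed_form_at p q x y) :
  a <= b -> c <= d -> boundary_integral p q a b c d = 0.
Proof.
intros Hab Hcd. apply NNPP. intros Hne.
(* [L] exceeds both sides, and the added 1 keeps it positive for a degenerate rectangle. *)
set (A := b - a). set (B := d - c). set (L := A + B + 1).
set (J := Rabs (boundary_integral p q a b c d)).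
assert (HJ : 0 < J) by now apply Rabs_pos_lt.
assert (HA : 0 <= A) by (unfold A; lra). assert (HB : 0 <= B) by (unfold B; lra).
set (h := fun n : nat => / 2 ^ n).
assert (Hh : forall n, 0 < h n).
{ intros n. apply Rinv_0_lt_compat, pow_lt. lra. }
assert (HhS : forall n, h n = 2 * h (S n)).
{ intros n. unfold h. simpl. field. apply pow_nonzero. lra. }
(* [z] is the lower left corner of the [n]-th rectangle; the factor [h n ^ 2] is the [n]-th power of
   one quarter. *)
set (Q := fun n (z : R * R) =>
  (a <= fst z /\ fst z + A * h n <= b) /\ (c <= snd z /\ snd z + B * h n <= d) /\
  J * h n ^ 2 <= Rabs (boundary_integral p q (fst z) (fst z + A * h n)
                         (snd z) (snd z + B * h n))).
set (E := fun n (z z' : R * R) =>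
  (fst z <= fst z' /\ fst z' + A * h (S n) <= fst z + A * h n) /\
  (snd z <= snd z' /\ snd z' + B * h (S n) <= snd z + B * h n)).
destruct (dependent_choice _ Q E (a, c)) as [u [Hu0 Hu]].
- unfold Q, h; simpl. rewrite Rinv_1. unfold A, B.
  replace (a + (b - a) * 1) with b by ring. replace (c + (d - c) * 1) with d by ring.
  repeat split; try lra. fold J. lra.
- intros n [x y] (Hx & Hy & HI). cbn [fst snd] in Hx, Hy, HI.
  assert (Ha := Hh (S n)). assert (Hs := HhS n).
  assert (PA : 0 <= A * h (S n)) by nra. assert (PB : 0 <= B * h (S n)) by nra.
  assert (EA : A * h n = A * h (S n) + A * h (S n)) by (rewrite Hs; ring).
  assert (EB : B * h n = B * h (S n) + B * h (S n)) by (rewrite Hs; ring).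
  rewrite EA, <- Rplus_assoc in Hx, HI. rewrite EB, <- Rplus_assoc in Hy, HI.
  rewrite (boundary_integral_split p q a b c d Hcl x (x + A * h (S n)) _ y (y + B * h (S n)))
    in HI by lra.
  assert (EJ : J * h n ^ 2 = 4 * (J * h (S n) ^ 2)) by (rewrite Hs; ring).
  rewrite EJ in HI.
  (* If the first three quarters all fall short, the triangle inequality leaves enough to the
     fourth. *)
  destruct (Rle_lt_dec (J * h (S n) ^ 2) (Rabs (boundary_integral p q x (x + A * h (S n))
    y (y + B * h (S n))))) as [I1|I1].
  { exists (x, y). unfold Q, E; cbn [fst snd]. repeat split; lra. }
  destruct (Rle_lt_dec (J * h (S n) ^ 2) (Rabs (boundary_integral p q (x + A * h (S n))
    (x + A * h (S n) + A * h (S n)) y (y + B * h (S n))))) as [I2|I2].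
  { exists (x + A * h (S n), y). unfold Q, E; cbn [fst snd]. repeat split; lra. }
  destruct (Rle_lt_dec (J * h (S n) ^ 2) (Rabs (boundary_integral p q x (x + A * h (S n))
    (y + B * h (S n)) (y + B * h (S n) + B * h (S n))))) as [I3|I3].
  { exists (x, y + B * h (S n)). unfold Q, E; cbn [fst snd]. repeat split; lra. }
  exists (x + A * h (S n), y + B * h (S n)). unfold Q, E; cbn [fst snd]. repeat split; try lra.
  apply Rabs_def2 in I1. apply Rabs_def2 in I2. apply Rabs_def2 in I3.
  revert HI. unfold Rabs at 1. destruct Rcase_abs; unfold Rabs; destruct Rcase_abs; lra.
- destruct (nested_intervals (fun n => fst (u n)) (fun n => A * h n)) as [x0 Hx0].
  { intros n. apply (Hu n). } { intros n. apply (Hu n). }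
  { intros n. specialize (Hh n). nra. }
  destruct (nested_intervals (fun n => snd (u n)) (fun n => B * h n)) as [y0 Hy0].
  { intros n. apply (Hu n). } { intros n. apply (Hu n). }
  { intros n. specialize (Hh n). nra. }
  assert (HL : 0 < L) by (unfold L; lra).
  assert (HL2 : 0 < L ^ 2) by (apply pow_lt; lra).
  (* With this [e], the bound [e * (L * h n) ^ 2] is half of [J * h n ^ 2]. *)
  assert (He : 0 < J / L ^ 2 / 2) by (apply Rdiv_lt_0_compat; [apply Rdiv_lt_0_compat |]; lra).
  destruct (boundary_integral_local p q a b c d Hcl x0 y0) with (e := J / L ^ 2 / 2)
    as (delta & Hd & Hloc); trivial.
  { destruct (Hu O) as [(H1 & H2 & _) _]. specialize (Hx0 O). simpl in *. lra. }
  { destruct (Hu O) as [(H1 & H2 & _) _]. specialize (Hy0 O). simpl in *. lra. }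
  destruct (pow_lt_1_zero (/2)) with (y := delta / L) as [N HN].
  { rewrite Rabs_pos_eq; lra. }
  { now apply Rdiv_lt_0_compat. }
  specialize (HN N (le_n N)). rewrite pow_inv in HN.
  fold (h N) in HN. specialize (Hh N). rewrite Rabs_pos_eq in HN by lra.
  destruct (Hu N) as [(H1 & H2 & H3) _]. specialize (Hx0 N). specialize (Hy0 N). simpl in Hx0, Hy0.
  assert (HLN : L * h N < delta).
  { apply (Rmult_lt_compat_l L) in HN; [|lra].
    replace (L * (delta / L)) with delta in HN by (field; lra). lra. }
  assert (K := Hloc _ _ _ _ (L * h N) (conj (proj1 H1) (proj1 Hx0)) (conj (proj2 Hx0) (proj2 H1))
     (conj (proj1 H2) (proj1 Hy0)) (conj (proj2 Hy0) (proj2 H2))).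
  assert (K' : Rabs (boundary_integral p q (fst (u N)) (fst (u N) + A * h N)
     (snd (u N)) (snd (u N) + B * h N)) <= J / L ^ 2 / 2 * (L * h N) ^ 2).
  { apply K; [unfold L; nra | unfold L; nra | assumption]. }
  replace (J / L ^ 2 / 2 * (L * h N) ^ 2) with (J * h N ^ 2 / 2) in K' by (field; lra).
  assert (0 < J * h N ^ 2) by (apply Rmult_lt_0_compat; [lra | apply pow_lt; lra]).
  lra.
Qed.

(** * Complex differentiability and the Cauchy-Riemann equations *)

(** The balls of the uniform structure on [C] are squares; the factor [sqrt 2] compares them with
    the discs of [Cmod]. *)
Lemma locally_Cmod (z : C) (Q : C -> Prop) :
  locally z Q <-> exists d : R, 0 < d /\ forall w, Cmod (w - z) < d -> Q w.
Proof.
split.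
- intros [e He]. exists e. split; [apply cond_pos |].
  intros w Hw. apply He. now apply C_NormedModule_mixin_compat1.
- intros (d & Hd & H).
  assert (H2 : 0 < sqrt 2) by (apply sqrt_lt_R0; lra).
  exists (mkposreal (d / sqrt 2) (Rdiv_lt_0_compat _ _ Hd H2)). intros w Hw. apply H.
  apply C_NormedModule_mixin_compat2 in Hw. simpl in Hw.
  replace (sqrt 2 * (d / sqrt 2)) with d in Hw by (field; lra). exact Hw.
Qed.

Lemma C_differentiable_eps (f : C -> C) (z : C) :
  C_differentiable f z <->
  exists l : C, forall e : R, 0 < e -> exists d : R, 0 < d /\
    forall w, Cmod (w - z) < d ->
      Cmod (f w - f z - l * (w - z)) <= e * Cmod (w - z).
Proof.
split.
- intros [l [_ H]]. exists l. intros e He.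
  destruct (H z (fun P HP => HP) (mkposreal e He)) as [d Hd].
  exists d. split; [apply cond_pos |]. intros w Hw.
  rewrite (Cmult_comm l). exact (Hd w Hw).
- intros [l H]. exists l. split; [exact (is_linear_scal_l (V := C_NormedModule) l) |].
  intros x Hx e. apply (is_filter_lim_locally_unique (V := AbsRing_NormedModule C_AbsRing)) in Hx.
  subst x. destruct (H e (cond_pos e)) as (d & Hd & Hl).
  exists (mkposreal d Hd). intros w Hw. specialize (Hl w Hw).
  rewrite (Cmult_comm l) in Hl. exact Hl.
Qed.

Lemma C_differentiable_continuous (f : C -> C) (z : C) (e : R) :
  C_differentiable f z -> 0 < e ->
  exists d : R, 0 < d /\ forall w, Cmod (w - z) < d -> Cmod (f w - f z) < e.
Proof.
intros [l H]%C_differentiable_eps He.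
destruct (H 1 Rlt_0_1) as (d & Hd & Hl).
assert (H0 := Cmod_ge_0 l).
exists (Rmin d (e / (Cmod l + 1))). split.
{ apply Rmin_pos; [assumption |]. apply Rdiv_lt_0_compat; lra. }
intros w Hw.
assert (Hw1 := Rlt_le_trans _ _ _ Hw (Rmin_l _ _)).
assert (Hw2 := Rlt_le_trans _ _ _ Hw (Rmin_r _ _)).
specialize (Hl w Hw1).
replace (f w - f z)%C with (f w - f z - l * (w - z) + l * (w - z))%C by ring.
eapply Rle_lt_trans; [apply Cmod_triangle |]. rewrite Cmod_mult.
apply (Rmult_lt_compat_l (Cmod l + 1)) in Hw2; [|lra].
replace ((Cmod l + 1) * (e / (Cmod l + 1))) with e in Hw2 by (field; lra). lra.
Qed.

Lemma C_differentiable_ext_loc (f g : C -> C) (z : C) :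
  locally z (fun w => f w = g w) -> C_differentiable f z -> C_differentiable g z.
Proof.
rewrite locally_Cmod, !C_differentiable_eps. intros (r & Hr & E) [l H]. exists l.
intros e He. destruct (H e He) as (d & Hd & Hl).
exists (Rmin d r). split; [now apply Rmin_pos |]. intros w Hw.
rewrite <- !E.
- apply Hl. exact (Rlt_le_trans _ _ _ Hw (Rmin_l _ _)).
- unfold Cminus. rewrite Cplus_opp_r, Cmod_0. assumption.
- exact (Rlt_le_trans _ _ _ Hw (Rmin_r _ _)).
Qed.

Lemma C_differentiable_const (c z : C) : C_differentiable (fun _ => c) z.
Proof. exact (ex_derive_const (V := C_NormedModule) c z). Qed.

Lemma C_differentiable_minus (f g : C -> C) (z : C) :
  C_differentiable f z -> C_differentiable g z ->
  C_differentiable (fun w => f w - g w)%C z.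
Proof. exact (ex_derive_minus (V := C_NormedModule) f g z). Qed.

(* The two structures have the same norm but different uniform structures. *)
Lemma is_derive_C_AbsRing (f : C -> C) (z l : C) :
  is_derive (K := C_AbsRing) (V := AbsRing_NormedModule C_AbsRing) f z l <->
  is_derive (K := C_AbsRing) (V := C_NormedModule) f z l.
Proof. split; intros [[H1 H2 H3] H]; (split; [constructor; assumption | exact H]). Qed.

Lemma C_differentiable_mult (f g : C -> C) (z : C) :
  C_differentiable f z -> C_differentiable g z ->
  C_differentiable (fun w => f w * g w)%C z.
Proof.
intros [l Hl%is_derive_C_AbsRing] [m Hm%is_derive_C_AbsRing].
exists (l * g z + f z * m)%C. apply is_derive_C_AbsRing.
apply (is_derive_mult (K := C_AbsRing) f g z l m); [exact Hl | exact Hm | exact Cmult_comm].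
Qed.

Lemma C_differentiable_comp_affine (f : C -> C) (a c z : C) :
  C_differentiable f (a + c * z)%C -> C_differentiable (fun w => f (a + c * w)%C) z.
Proof.
rewrite !C_differentiable_eps. intros [l H]. exists (l * c)%C. intros e He.
(* The added 1 keeps [k] positive when [c] is zero. *)
assert (H0 := Cmod_ge_0 c). set (k := Cmod c + 1).
assert (Hk : 0 < k) by (unfold k; lra).
destruct (H (e / k)) as (d & Hd & Hl); [now apply Rdiv_lt_0_compat |].
exists (d / k). split; [now apply Rdiv_lt_0_compat |]. intros w Hw.
assert (E : Cmod (a + c * w - (a + c * z)) = Cmod c * Cmod (w - z)).
{ rewrite <- Cmod_mult. f_equal. ring. }
assert (H1 := Cmod_ge_0 (w - z)).
assert (B : Cmod c * Cmod (w - z) <= k * Cmod (w - z)) by (unfold k; lra).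
replace (f (a + c * w) - f (a + c * z) - l * c * (w - z))%C with
  (f (a + c * w) - f (a + c * z) - l * (a + c * w - (a + c * z)))%C by ring.
apply (Rmult_lt_compat_l k) in Hw; [|lra].
replace (k * (d / k)) with d in Hw by (field; lra).
eapply Rle_trans; [apply Hl; lra |]. rewrite E.
apply Rmult_le_compat_l with (r := e / k) in B;
  [|apply Rlt_le; now apply Rdiv_lt_0_compat].
replace (e / k * (k * Cmod (w - z))) with (e * Cmod (w - z)) in B by (field; lra). exact B.
Qed.

Lemma C_differentiable_conj (f : C -> C) (z : C) :
  C_differentiable f (Cconj z) -> C_differentiable (fun w => Cconj (f (Cconj w))) z.
Proof.
rewrite !C_differentiable_eps. intros [l H]. exists (Cconj l). intros e He.
destruct (H e He) as (d & Hd & Hl). exists d. split; [assumption |]. intros w Hw.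
assert (E : Cmod (Cconj w - Cconj z) = Cmod (w - z)).
{ now rewrite <- Cminus_conj, Cmod_conj. }
rewrite <- Cmod_conj, !Cminus_conj, Cmult_conj, !Cconj_conj, Cminus_conj, <- E.
apply Hl. now rewrite E.
Qed.

Lemma Cauchy_Riemann (f : C -> C) (x y : R) :
  C_differentiable f (x, y) -> exists a b : R,
    differentiable_pt_lim (fun u v => Re (f (u, v))) x y a (- b) /\
    differentiable_pt_lim (fun u v => Im (f (u, v))) x y b a.
Proof.
intros [[a b] H]%C_differentiable_eps. exists a, b.
assert (K : forall e : posreal, exists d : posreal, forall u v,
  Rabs (u - x) < d -> Rabs (v - y) < d ->
  Cmod (f (u, v) - f (x, y) - (a, b) * ((u, v) - (x, y))) <=
    e * Rmax (Rabs (u - x)) (Rabs (v - y))).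
{ intros e.
  assert (H2 : 0 < sqrt 2) by (apply sqrt_lt_R0; lra).
  (* [differentiable_pt_lim] measures increments in the max norm, and [Cmod] is at most [sqrt 2]
     times that norm. *)
  destruct (H (e / sqrt 2)) as (d & Hd & Hl).
  { apply Rdiv_lt_0_compat; [apply cond_pos | assumption]. }
  exists (mkposreal (d / sqrt 2) (Rdiv_lt_0_compat _ _ Hd H2)). simpl. intros u v Hu Hv.
  assert (M := Cmod_2Rmax ((u, v) - (x, y))).
  cbn [fst snd Cminus Cplus Copp] in M.
  change (u + - x) with (u - x) in M. change (v + - y) with (v - y) in M.
  assert (M' : Rmax (Rabs (u - x)) (Rabs (v - y)) < d / sqrt 2) by now apply Rmax_lub_lt.
  apply (Rmult_lt_compat_l (sqrt 2)) in M'; [|assumption].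
  replace (sqrt 2 * (d / sqrt 2)) with d in M' by (field; lra).
  eapply Rle_trans; [apply Hl; lra |].
  apply Rmult_le_compat_l with (r := e / sqrt 2) in M.
  2: { apply Rlt_le, Rdiv_lt_0_compat; [apply cond_pos | assumption]. }
  eapply Rle_trans; [exact M |]. right. field. lra. }
split; intros e; destruct (K e) as [d Hd]; exists d; intros u v Hu Hv;
  (eapply Rle_trans; [| exact (Hd u v Hu Hv)]);
  (eapply Rle_trans; [| apply Rmax_Cmod]).
- eapply Rle_trans; [| apply Rmax_l]. right. f_equal.
  destruct (f (u, v)), (f (x, y)). simpl. ring.
- eapply Rle_trans; [| apply Rmax_r]. right. f_equal.
  destruct (f (u, v)), (f (x, y)). simpl. ring.
Qed.

(** * Means over concentric circles *)

Lemma differentiable_pt_lim_mult (x y : R) :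
  differentiable_pt_lim (fun u v => u * v) x y y x.
Proof.
intros e. exists e. intros u v Hu Hv.
replace (u * v - x * y - (y * (u - x) + x * (v - y))) with ((u - x) * (v - y)) by ring.
rewrite Rabs_mult. apply Rmult_le_compat; try apply Rabs_pos; [lra | apply Rmax_r].
Qed.

Lemma differentiable_pt_lim_snd (f : R -> R) (x y l : R) :
  derivable_pt_lim f y l -> differentiable_pt_lim (fun _ v => f v) x y 0 l.
Proof.
intros H e. destruct (differentiable_pt_lim_proj1_0 f y x l H e) as [d Hd].
exists d. intros u v Hu Hv. specialize (Hd v u Hv Hu).
rewrite Rmax_comm, (Rplus_comm (0 * _)). exact Hd.
Qed.

(** This is [exp (s + i t)]: circles about 0 become vertical segments, so Goursat's theorem for
    rectangles applies to annuli. *)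
Definition polar (s t : R) : C := (exp s * cos t, exp s * sin t).

Lemma Cmod_polar (s t : R) : Cmod (polar s t) = exp s.
Proof.
unfold Cmod, polar; cbn [fst snd].
replace ((exp s * cos t) ^ 2 + (exp s * sin t) ^ 2) with (Rsqr (exp s) * (Rsqr (sin t) + Rsqr (cos t)))
  by (unfold Rsqr; ring).
rewrite sin2_cos2, Rmult_1_r. apply sqrt_Rsqr. apply Rlt_le, exp_pos.
Qed.

(* The Cauchy-Riemann equations of [w |-> G (exp w)], [w = s + i t]. *)
Lemma closed_form_polar (G : C -> C) (s t : R) :
  C_differentiable G (polar s t) ->
  closed_form_at (fun s t => Im (G (polar s t))) (fun s t => Re (G (polar s t))) s t.
Proof.
intros HG. destruct (Cauchy_Riemann G _ _ HG) as (a & b & HRe & HIm).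
assert (Hexp : differentiable_pt_lim (fun u _ => exp u) s t (exp s) 0).
{ apply differentiable_pt_lim_proj1_0, derivable_pt_lim_exp. }
assert (Hx : differentiable_pt_lim (fun u v => exp u * cos v) s t
   (cos t * exp s + exp s * 0) (cos t * 0 + exp s * - sin t)).
{ apply (differentiable_pt_lim_comp (fun u v => u * v) (fun u _ => exp u) (fun _ v => cos v));
    [apply differentiable_pt_lim_mult | exact Hexp |].
  apply differentiable_pt_lim_snd, derivable_pt_lim_cos. }
assert (Hy : differentiable_pt_lim (fun u v => exp u * sin v) s t
   (sin t * exp s + exp s * 0) (sin t * 0 + exp s * cos t)).
{ apply (differentiable_pt_lim_comp (fun u v => u * v) (fun u _ => exp u) (fun _ v => sin v));
    [apply differentiable_pt_lim_mult | exact Hexp |].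
  apply differentiable_pt_lim_snd, derivable_pt_lim_sin. }
assert (DRe := differentiable_pt_lim_comp _ _ _ _ _ _ _ _ _ _ _ HRe Hx Hy).
assert (DIm := differentiable_pt_lim_comp _ _ _ _ _ _ _ _ _ _ _ HIm Hx Hy).
(* The form is the imaginary part of [G (exp w) dw]. The [ring] below identifies the [t]-derivative
   of [Im G] with the [s]-derivative of [Re G]. *)
eexists. eexists. eexists. split; [exact DIm |].
match goal with |- differentiable_pt_lim _ _ _ ?B _ =>
  match type of DRe with differentiable_pt_lim _ _ _ ?B' _ =>
    replace B with B' by ring end end.
exact DRe.
Qed.

(* The mean of [G] over the circle of radius [exp s] does not depend on [s]
   and tends to [G 0] as [s] goes to minus infinity. *)
Theorem zero_on_circle_center (G : C -> C) (r : R) :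
  0 < r -> (forall z, Cmod z <= r -> C_differentiable G z) ->
  (forall z, Cmod z = r -> G z = RtoC 0) -> G (RtoC 0) = RtoC 0.
Proof.
intros Hr HG Hz. apply NNPP. intros Hne.
(* This factor makes the value at 0 the positive real [m], so that real parts suffice. *)
set (H := fun z => (Cconj (G (RtoC 0)) * G z)%C).
assert (HH : forall z, Cmod z <= r -> C_differentiable H z).
{ intros z Hzr. apply C_differentiable_mult; [apply C_differentiable_const | now apply HG]. }
set (m := Cmod (G (RtoC 0)) ^ 2).
assert (Hm : 0 < m) by (apply pow_lt; now apply Cmod_gt_0).
assert (H0 : Re (H (RtoC 0)) = m).
{ unfold H, m. rewrite Cmod2_alt. destruct (G (RtoC 0)). simpl. ring. }
destruct (C_differentiable_continuous H (RtoC 0) (m / 2)) as (d & Hd & Hc).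
{ apply HH. rewrite Cmod_0. lra. }
{ lra. }
set (s1 := ln (Rmin r (d / 2))). set (s2 := ln r).
assert (Hmin : 0 < Rmin r (d / 2)) by (apply Rmin_pos; lra).
assert (E1 : exp s1 = Rmin r (d / 2)) by now apply exp_ln.
assert (E2 : exp s2 = r) by now apply exp_ln.
assert (H12 : s1 <= s2).
{ apply ln_le; [assumption | apply Rmin_l]. }
assert (Hpi := PI_RGT_0).
assert (Hcl : forall x y, s1 <= x <= s2 -> 0 <= y <= 2 * PI ->
  closed_form_at (fun s t => Im (H (polar s t))) (fun s t => Re (H (polar s t))) x y).
{ intros x y Hx Hy. apply closed_form_polar, HH. rewrite Cmod_polar, <- E2.
  destruct (Rle_lt_or_eq_dec x s2) as [L| ->]; [lra | | lra].
  apply Rlt_le, exp_increasing, L. }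
assert (Z := boundary_integral_closed _ _ s1 s2 0 (2 * PI) Hcl H12 ltac:(lra)).
unfold boundary_integral in Z.
(* The sides [t = 0] and [t = 2 * PI] have the same image under [polar], so they cancel; the side
   [s = s2] lies over the circle where [G] vanishes. *)
rewrite (RInt_ext (fun t => Im (H (polar t (2 * PI)))) (fun t => Im (H (polar t 0)))) in Z.
2: { intros x _. unfold polar. now rewrite cos_2PI, sin_2PI, cos_0, sin_0. }
rewrite (RInt_ext (fun t => Re (H (polar s2 t))) (fun _ => 0)) in Z.
2: { intros x _. unfold H. rewrite (Hz (polar s2 x)); [| now rewrite Cmod_polar, E2].
  rewrite Cmult_0_r. reflexivity. }
rewrite RInt_const in Z. unfold scal in Z; simpl in Z; unfold mult in Z; simpl in Z.
(* Only the inner circle remains in [Z], and there the real part of [H] is at least [m / 2] by the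
   choice of [d]. *)
assert (P : RInt (fun _ => m / 2) 0 (2 * PI) <= RInt (fun t => Re (H (polar s1 t))) 0 (2 * PI)).
{ apply RInt_le; [lra | apply ex_RInt_const | |].
  - apply (proj2 (ex_RInt_edges _ _ _ _ _ _ Hcl)); lra.
  - intros t Ht.
    assert (Hp : Cmod (H (polar s1 t) - H (RtoC 0)) < m / 2).
    { apply Hc. replace (polar s1 t - RtoC 0)%C with (polar s1 t) by ring.
      rewrite Cmod_polar, E1. assert (Q := Rmin_r r (d / 2)). lra. }
    assert (Q := re_le_Cmod (H (polar s1 t) - H (RtoC 0))).
    replace (Re (H (polar s1 t) - H (RtoC 0))) with (Re (H (polar s1 t)) - m) in Q
      by (rewrite <- H0; reflexivity).
    apply Rabs_le_between in Q. lra. }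
rewrite RInt_const in P. unfold scal in P; simpl in P; unfold mult in P; simpl in P.
assert (0 < (2 * PI - 0) * (m / 2)) by (apply Rmult_lt_0_compat; lra).
lra.
Qed.

(** * Propagation of zeros *)

(** The scalar product [X] and cross product [Y] of [d] and [w] satisfy
    [X ^ 2 + Y ^ 2 = (Cmod d * Cmod w) ^ 2]. Hence some quarter turn of [w] points back against [d],
    within 45 degrees. *)
Lemma quarter_turn_into_disc (d w : C) (s : R) :
  0 < s -> s <= Cmod d < 6 / 5 * s -> Cmod w = s / 2 ->
  Cmod (d + RtoC 1 * w) < s \/ Cmod (d + Ci * w) < s \/
  Cmod (d + - RtoC 1 * w) < s \/ Cmod (d + - Ci * w) < s.
Proof.
intros Hs [Hd1 Hd2] Hw.
assert (Dd := Cmod2_alt d). assert (Dw := Cmod2_alt w). rewrite Hw in Dw.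
set (D := Cmod d) in *. destruct d as [d1 d2], w as [w1 w2]. simpl Re in *. simpl Im in *.
assert (Hlt : forall u v, u ^ 2 + v ^ 2 < s ^ 2 -> Cmod (u, v) < s).
{ intros u v H. unfold Cmod. rewrite <- (sqrt_pow2 s) by lra.
  apply sqrt_lt_1_alt. cbn [fst snd]. nra. }
set (X := d1 * w1 + d2 * w2). set (Y := d1 * w2 - d2 * w1).
assert (HXY : X ^ 2 + Y ^ 2 = (D * (s / 2)) ^ 2).
{ rewrite Rpow_mult_distr, Dd, Dw. unfold X, Y. ring. }
(* 7/10 is a rational below [1 / sqrt 2] that still suffices at the extreme [D = 6 / 5 * s], as
   36/25 + 1/4 - 21/25 < 1. *)
set (k := 7 / 10 * (D * (s / 2))).
assert (Hk : 0 <= k) by (unfold k; nra).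
assert (Hkk : D ^ 2 + (s / 2) ^ 2 - 2 * k < s ^ 2) by (unfold k; nra).
assert (Hcase : X <= - k \/ k <= X \/ Y <= - k \/ k <= Y).
{ apply NNPP. intros N.
  assert (X ^ 2 <= k ^ 2 /\ Y ^ 2 <= k ^ 2) by (split; nra).
  assert (0 < D * (s / 2)) by nra. unfold k in *. nra. }
assert (E : forall u v, (d1 + u) ^ 2 + (d2 + v) ^ 2 =
  D ^ 2 + (u ^ 2 + v ^ 2) + 2 * (d1 * u + d2 * v)) by (intros; rewrite Dd; ring).
unfold Ci, RtoC, Cplus, Cmult, Copp; cbn [fst snd].
destruct Hcase as [H|[H|[H|H]]].
- left. apply Hlt. rewrite E. unfold X in H. nra.
- right; right; left. apply Hlt. rewrite E. unfold X in H. nra.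
- right; right; right. apply Hlt. rewrite E. unfold Y in H. nra.
- right; left. apply Hlt. rewrite E. unfold Y in H. nra.
Qed.

(* For [a] just outside the disc, every point of the circle of radius [s / 2]
   about [a] is brought into the disc by one of the four quarter turns about
   [a], so [w |-> F (a + w) F (a + i w) F (a - w) F (a - i w)] vanishes on a
   circle, hence at its center. *)
Lemma zero_disc_grow (F : C -> C) (b : C) (s : R) :
  0 < s -> (forall z, Cmod (z - b) < 2 * s -> C_differentiable F z) ->
  (forall z, Cmod (z - b) < s -> F z = RtoC 0) ->
  forall a, Cmod (a - b) < 6 / 5 * s -> F a = RtoC 0.
Proof.
intros Hs HF Hz a Ha.
destruct (Rlt_le_dec (Cmod (a - b)) s) as [L|L]; [now apply Hz |].
set (G := fun w => (F (a + RtoC 1 * w) * F (a + Ci * w) *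
                    (F (a + - RtoC 1 * w) * F (a + - Ci * w)))%C).
assert (Hdist : forall c w, Cmod c = 1 -> Cmod w <= s / 2 -> Cmod (a + c * w - b) < 2 * s).
{ intros c w Hc Hw. replace (a + c * w - b)%C with (a - b + c * w)%C by ring.
  eapply Rle_lt_trans; [apply Cmod_triangle |]. rewrite Cmod_mult, Hc. lra. }
assert (G0 : G (RtoC 0) = RtoC 0).
{ apply (zero_on_circle_center G (s / 2)); [lra | |].
  - intros w Hw.
    apply C_differentiable_mult; apply C_differentiable_mult;
      apply (C_differentiable_comp_affine F); apply HF, Hdist;
      rewrite ?Cmod_opp, ?Cmod_1, ?Cmod_Ci; trivial.
  - intros w Hw. unfold G.
    destruct (quarter_turn_into_disc (a - b) w s Hs (conj L Ha) Hw) as [H|[H|[H|H]]];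
    match type of H with Cmod (_ + ?u) < _ =>
      rewrite (Hz (a + u)%C) by (replace (a + u - b)%C with (a - b + u)%C by ring; exact H) end;
    ring. }
(* At 0 the product is the fourth power of [F a]. *)
unfold G in G0. rewrite !Cmult_0_r, Cplus_0_r in G0.
apply NNPP. intros N. apply (Cmult_neq_0 (F a * F a) (F a * F a)); trivial;
  now apply Cmult_neq_0.
Qed.

(** [zero_disc_grow] is iterated, each time enlarging the radius by 6/5. The cap [S / 2] keeps the
    disc of twice the radius inside the domain. *)
Lemma zero_half_disc (F : C -> C) (b : C) (S : R) :
  (forall z, Cmod (z - b) < S -> C_differentiable F z) ->
  locally b (fun z => F z = RtoC 0) ->
  forall z, Cmod (z - b) < S / 2 -> F z = RtoC 0.
Proof.
intros HF [s [Hs Hz]]%locally_Cmod z Hzb.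
assert (HS : 0 < S) by (assert (H := Cmod_ge_0 (z - b)); lra).
assert (K : forall n w, Cmod (w - b) < Rmin (s * (6 / 5) ^ n) (S / 2) -> F w = RtoC 0).
{ induction n as [|n IH]; intros w Hw.
  - apply Hz. eapply Rlt_le_trans; [exact Hw |]. rewrite pow_O, Rmult_1_r. apply Rmin_l.
  - assert (Hp : 0 < s * (6 / 5) ^ n) by (apply Rmult_lt_0_compat; [lra | apply pow_lt; lra]).
    assert (L := Rmin_r (s * (6 / 5) ^ n) (S / 2)).
    apply (zero_disc_grow F b (Rmin (s * (6 / 5) ^ n) (S / 2))); trivial.
    + apply Rmin_pos; lra.
    + intros v Hv. apply HF. lra.
    + eapply Rlt_le_trans; [exact Hw |]. simpl. unfold Rmin.
      repeat destruct Rle_dec; lra. }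
destruct (Pow_x_infinity (6 / 5)) with (b := S / s) as [N HN].
{ rewrite Rabs_pos_eq; lra. }
apply (K N). specialize (HN N (le_n N)).
assert (Hp : 0 < (6 / 5) ^ N) by (apply pow_lt; lra).
rewrite Rabs_pos_eq in HN by lra.
assert (HN' := Rmult_le_compat_l s _ _ (Rlt_le _ _ Hs) (Rge_le _ _ HN)).
replace (s * (S / s)) with S in HN' by (field; lra).
apply Rmin_glb_lt; lra.
Qed.

Lemma locally_Cmod_intro (z : C) (d : R) (Q : C -> Prop) :
  0 < d -> (forall w, Cmod (w - z) < d -> Q w) -> locally z Q.
Proof. intros Hd H. apply locally_Cmod. now exists d. Qed.

Lemma Cmod_vertical (x s t : R) : Cmod ((x, s) - (x, t)) = Rabs (s - t).
Proof.
rewrite <- Cmod_R.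
replace ((x, s) - (x, t))%C with (Ci * RtoC (s - t))%C.
- rewrite Cmod_mult, Cmod_Ci. ring.
- unfold Ci, RtoC, Cminus, Cplus, Cmult, Copp; simpl. f_equal; ring.
Qed.

(** Connectedness of the segment: a zero disc centred just below the supremum [m] of the heights
    reached extends beyond [m]. *)
Lemma zero_along_vertical (F : C -> C) (x c d : R) :
  c <= d ->
  (forall t, c <= t <= d -> locally ((x, t) : C) (C_differentiable F)) ->
  locally ((x, c) : C) (fun z => F z = RtoC 0) -> F (x, d) = RtoC 0.
Proof.
intros Hcd HF H0.
set (E := fun t => c <= t <= d /\ locally ((x, t) : C) (fun z => F z = RtoC 0)).
destruct (completeness E) as [m [Ub Lub]].
{ exists d. intros t [Ht _]. lra. }
{ exists c. split; [lra | exact H0]. }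
assert (Hcm : c <= m) by (apply Ub; split; [lra | exact H0]).
assert (Hmd : m <= d) by (apply Lub; intros t [Ht _]; lra).
destruct (proj1 (locally_Cmod _ _) (HF m (conj Hcm Hmd))) as (r & Hr & HFr).
assert (Ht : exists t, E t /\ m - r / 8 < t).
{ apply NNPP. intros N. assert (m <= m - r / 8); [|lra].
  apply Lub. intros t Ht. apply Rnot_lt_le. intros L. apply N. now exists t. }
destruct Ht as (t & Ht & Hmt). assert (Htm : t <= m) by now apply Ub.
destruct Ht as [Htd Ht].
(* Since [t] is within [r / 8] of [m], the disc of radius [7 * r / 8] about it stays in the domain.
   Half of that radius exceeds [3 * r / 8], enough for a disc of radius [r / 8] about the point [t']
   below. *)
assert (Hz : forall z, Cmod (z - (x, t)) < (7 * r / 8) / 2 -> F z = RtoC 0).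
{ apply zero_half_disc; [|exact Ht]. intros z Hz. apply HFr.
  replace (z - (x, m))%C with (z - (x, t) + ((x, t) - (x, m)))%C by ring.
  eapply Rle_lt_trans; [apply Cmod_triangle |]. rewrite Cmod_vertical.
  rewrite Rabs_left1; lra. }
destruct (Rlt_le_dec m d) as [L|L].
- set (t' := Rmin d (m + r / 8)).
  assert (Ht' : m < t' <= m + r / 8).
  { split; [apply Rmin_glb_lt; lra | apply Rmin_r]. }
  assert (t' <= m); [|lra]. apply Ub. split.
  { assert (H := Rmin_l d (m + r / 8)). fold t' in H. lra. }
  apply (locally_Cmod_intro _ (r / 8)); [lra |]. intros z Hzt. apply Hz.
  replace (z - (x, t))%C with (z - (x, t') + ((x, t') - (x, t)))%C by ring.
  eapply Rle_lt_trans; [apply Cmod_triangle |]. rewrite Cmod_vertical.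
  rewrite Rabs_pos_eq; lra.
- apply Hz. rewrite Cmod_vertical, Rabs_pos_eq; lra.
Qed.

(** * Avoiding the discrete exceptional set *)

(** By compactness finitely many balls, each meeting [D] at most in its centre, cover the box; the
    list consists of the centres. *)
Lemma discrete_finite_in_box (D : C -> Prop) (M : R) :
  (forall z, locally' z (fun w => ~ D w)) ->
  exists l : list C, forall z, Rabs (Re z) <= M -> Rabs (Im z) <= M -> D z -> In z l.
Proof.
intros HD.
destruct (functional_choice (A := Compactness.Tn 2 R) (B := posreal)
  (fun t e => forall y : C, ball ((fst t, fst (snd t)) : C) e y ->
     y <> (fst t, fst (snd t)) -> ~ D y)) as [delta Hdelta].
{ intros t. exact (HD (fst t, fst (snd t))). }
destruct (NNPP _ (compactness_list 2 (- M, (- M, tt)) (M, (M, tt)) delta)) as [l Hl].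
exists (map (fun t : Compactness.Tn 2 R => ((fst t, fst (snd t)) : C)) l).
intros [x y] Hx Hy Hxy. simpl in Hx, Hy.
apply Rabs_le_between in Hx. apply Rabs_le_between in Hy.
destruct (Hl (x, (y, tt))) as ([t1 [t2 []]] & Hin & _ & Hclose).
{ repeat split; lra. }
apply in_map_iff. exists (t1, (t2, tt)). split; [|exact Hin].
apply NNPP. intros N. apply (Hdelta (t1, (t2, tt)) (x, y)); trivial.
- destruct Hclose as (H1 & H2 & _). split; assumption.
- intros E. apply N. symmetry. exact E.
Qed.

(** One halving per element: at least one open half misses it. *)
Lemma interval_avoids_list (l : list R) (a b : R) :
  a < b -> exists a' b', a <= a' /\ a' < b' /\ b' <= b /\
    forall x, a' < x < b' -> ~ In x l.
Proof.
intros Hab. induction l as [|y l (a' & b' & H1 & H2 & H3 & H)].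
- exists a, b. repeat split; try lra. intros x _ [].
- destruct (Rle_lt_dec y ((a' + b') / 2)) as [L|L].
  + exists ((a' + b') / 2), b'. repeat split; try lra.
    intros x Hx [E|E]; [lra |]. apply (H x); [lra | exact E].
  + exists a', ((a' + b') / 2). repeat split; try lra.
    intros x Hx [E|E]; [lra |]. apply (H x); [lra | exact E].
Qed.

Lemma discrete_complement_open (D : C -> Prop) (z : C) :
  locally' z (fun w => ~ D w) -> ~ D z -> locally z (fun w => ~ D w).
Proof.
intros [e He] Hz. exists e. intros w Hw.
destruct (classic (w = z)) as [->|N]; [exact Hz | exact (He w Hw N)].
Qed.

(* Almost every vertical line misses [D], and along such a line the zeros of
   [F] propagate upwards from the lower half plane. *)
Theorem zero_from_lower_half_plane (F : C -> C) (D : C -> Prop) (z : C) :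
  (forall w, locally' w (fun v => ~ D v)) ->
  (forall w, ~ D w -> C_differentiable F w) ->
  (forall w, Im w <= 0 -> F w = RtoC 0) -> ~ D z -> F z = RtoC 0.
Proof.
intros HD HF H0 Hz. destruct z as [x y].
destruct (Rle_lt_dec y 0) as [Hy|Hy]; [now apply H0 |].
apply NNPP. intros N. apply Cmod_gt_0 in N.
(* With [Cmod (F z)] as tolerance, [F] has no zero within [d] of [z]; a vertical line that close
   will contradict this. *)
destruct (C_differentiable_continuous F (x, y) _ (HF _ Hz) N) as (d & Hd & Hc).
set (M := Rabs x + d + y + 1).
destruct (discrete_finite_in_box D M HD) as [l Hl].
destruct (interval_avoids_list (map Re l) x (x + d)) as (a & b & Ha & Hab & Hb & Hl'); [lra |].
set (x' := (a + b) / 2).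
assert (Hx : Rabs x <= M /\ x < x' < x + d /\ Rabs x' <= M).
{ assert (H1 := Rle_abs x). assert (H2 := Rabs_maj2 x).
  unfold M, x'. repeat split; try lra. apply Rabs_le. lra. }
(* The segment starts at height -1 so that a whole disc about its lower end lies where [F]
   vanishes. *)
assert (Hvert : forall t, -1 <= t <= y -> ~ D (x', t)).
{ intros t Ht HDt. apply (Hl' x'); [unfold x'; lra |].
  change x' with (Re (x', t)). apply in_map, Hl; trivial; simpl; [lra |].
  assert (H1 := Rabs_pos x). apply Rabs_le. unfold M. lra. }
assert (E : F (x', y) = RtoC 0).
{ apply (zero_along_vertical F x' (-1) y); [lra | |].
  - intros t Ht. generalize (discrete_complement_open D _ (HD _) (Hvert t Ht)).
    apply filter_imp. exact HF.
  - apply (locally_Cmod_intro _ 1); [lra |]. intros w Hw. apply H0.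
    assert (H1 := Rle_trans _ _ _ (Rmax_r _ _) (Rmax_Cmod (w - (x', -1))%C)).
    destruct w as [w1 w2]. simpl in H1 |- *.
    assert (H2 := Rle_abs (w2 + - - 1)). lra. }
assert (B := Hc (x', y)). rewrite E in B.
assert (E0 : ((x', y) - (x, y))%C = RtoC (x' - x)).
{ unfold RtoC, Cminus, Cplus, Copp; simpl. f_equal; ring. }
rewrite E0, Cmod_R, Rabs_pos_eq in B by lra.
unfold Cminus in B at 1. rewrite Cplus_0_l, Cmod_opp in B. lra.
Qed.

(** * Gluing across the real line and reflection *)

(** A complex derivative is determined along the real direction alone, where all difference
    quotients are zero. *)
Lemma derivative_zero_on_line (h : C -> C) (z l : C) (d : R) :
  0 < d -> (forall t : R, Rabs t < d -> h (z + RtoC t)%C = RtoC 0) ->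
  (forall e, 0 < e -> exists r, 0 < r /\ forall w, Cmod (w - z) < r ->
     Cmod (h w - h z - l * (w - z)) <= e * Cmod (w - z)) ->
  h z = RtoC 0 /\ l = RtoC 0.
Proof.
intros Hd H0 Hl.
assert (Hz : h z = RtoC 0).
{ rewrite <- (Cplus_0_r z). apply H0. rewrite Rabs_R0. exact Hd. }
split; [exact Hz |]. apply NNPP. intros N. apply Cmod_gt_0 in N.
destruct (Hl (Cmod l / 2)) as (r & Hr & H); [lra |].
set (t := Rmin r d / 2).
assert (Ht : 0 < t /\ t < r /\ t < d).
{ assert (H1 := Rmin_l r d). assert (H2 := Rmin_r r d).
  assert (H3 := Rmin_pos r d Hr Hd). unfold t. lra. }
assert (E : (z + RtoC t - z)%C = RtoC t) by ring.
specialize (H (z + RtoC t)%C). rewrite E, Cmod_R, Rabs_pos_eq, Hz, H0 in H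
  by (rewrite ?Rabs_pos_eq; lra).
specialize (H ltac:(lra)).
replace (RtoC 0 - RtoC 0 - l * RtoC t)%C with (- (l * RtoC t))%C in H by ring.
rewrite Cmod_opp, Cmod_mult, Cmod_R, Rabs_pos_eq in H by lra. nra.
Qed.

(* On the real line [h] and its derivative both vanish, so gluing [h] with [0]
   preserves complex differentiability there. *)
Lemma C_differentiable_glue (h : C -> C) (z : C) :
  C_differentiable h z ->
  (Im z = 0 -> exists d, 0 < d /\ forall t : R, Rabs t < d -> h (z + RtoC t)%C = RtoC 0) ->
  C_differentiable (fun w => if Rlt_dec 0 (Im w) then h w else RtoC 0) z.
Proof.
intros Hh Hreal.
assert (Him : forall w, Rabs (Im w - Im z) <= Cmod (w - z)).
{ intros w. exact (Rle_trans _ _ _ (Rmax_r _ _) (Rmax_Cmod (w - z)%C)). }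
destruct (Rtotal_order (Im z) 0) as [L|[E|L]].
- apply (C_differentiable_ext_loc (fun _ => RtoC 0)); [|apply C_differentiable_const].
  apply (locally_Cmod_intro _ (- Im z)); [lra |]. intros w Hw.
  specialize (Him w). apply Rabs_le_between in Him. destruct Rlt_dec; [lra | reflexivity].
- destruct (Hreal E) as (d & Hd & H0).
  destruct (proj1 (C_differentiable_eps _ _) Hh) as [l Hl].
  destruct (derivative_zero_on_line h z l d Hd H0 Hl) as [Hz ->].
  apply C_differentiable_eps. exists (RtoC 0). intros e He.
  destruct (Hl e He) as (r & Hr & H). exists r. split; [exact Hr |]. intros w Hw.
  specialize (H w Hw). rewrite Hz in H. rewrite (E : Im z = 0).
  destruct (Rlt_dec 0 0) as [C|_]; [lra |].
  destruct Rlt_dec; [exact H |].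
  replace (RtoC 0 - RtoC 0 - RtoC 0 * (w - z))%C with (RtoC 0) by ring.
  rewrite Cmod_0. assert (P := Cmod_ge_0 (w - z)). nra.
- apply (C_differentiable_ext_loc h); [|exact Hh].
  apply (locally_Cmod_intro _ (Im z)); [lra |]. intros w Hw.
  specialize (Him w). apply Rabs_le_between in Him. destruct Rlt_dec; [reflexivity | lra].
Qed.

Lemma locally'_conj (z : C) (Q : C -> Prop) :
  locally' (Cconj z) Q -> locally' z (fun w => Q (Cconj w)).
Proof.
intros (d & Hd & H)%(locally_Cmod (Cconj z) (fun w => w <> Cconj z -> Q w)).
apply (locally_Cmod_intro z d (fun w => w <> z -> Q (Cconj w))); [exact Hd |].
intros w Hw N. apply H.
- rewrite <- Cminus_conj, Cmod_conj. exact Hw.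
- intros E. apply N. rewrite <- (Cconj_conj w), E. apply Cconj_conj.
Qed.

(** Both points are assumed off [P], because the symmetry of [P] is itself deduced from this
    identity. *)
Lemma conj_symmetric_off_poles (f : C -> C) (P : C -> Prop)
  (f_mero : meromorphic f P)
  (f_real : forall x : R, ~ P (RtoC x) -> exists y : R, f (RtoC x) = RtoC y) (z : C) :
  ~ P z -> ~ P (Cconj z) -> f (Cconj z) = Cconj (f z).
Proof.
destruct f_mero as [Hdisc Hholo _].
(* [D] is closed under conjugation, so both terms of [h] are holomorphic off it. *)
set (D := fun w => P w \/ P (Cconj w)).
set (h := fun w => (f w - Cconj (f (Cconj w)))%C).
assert (HD : forall w, locally' w (fun v => ~ D v)).
{ intros w. generalize (filter_and _ _ (Hdisc w) (locally'_conj w _ (Hdisc (Cconj w)))).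
  apply filter_imp. intros v [H1 H2] [H|H]; tauto. }
assert (Hreal : forall x : R, ~ P (RtoC x) -> h (RtoC x) = RtoC 0).
{ intros x Hx. unfold h.
  assert (Ex : forall y : R, Cconj (RtoC y) = RtoC y).
  { intros y. unfold Cconj, RtoC; simpl. now rewrite Ropp_0. }
  destruct (f_real x Hx) as [y Hy]. rewrite Ex, Hy, Ex. ring. }
assert (Hpos : forall w, ~ D w -> 0 < Im w -> h w = RtoC 0).
{ intros w Hw Hi.
  assert (Z := zero_from_lower_half_plane
    (fun w => if Rlt_dec 0 (Im w) then h w else RtoC 0) D w HD).
  cbv beta in Z. destruct (Rlt_dec 0 (Im w)) as [_|N]; [|tauto]. apply Z; trivial.
  - intros v Hv. apply C_differentiable_glue.
    + apply C_differentiable_minus; [apply Hholo; unfold D in Hv; tauto |].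
      apply C_differentiable_conj, Hholo. unfold D in Hv; tauto.
    (* The complement of [D] is open, so a real point off [D] has a real interval around it on which
       [h] vanishes. *)
    + intros Ev.
      destruct (proj1 (locally_Cmod _ _) (discrete_complement_open D v (HD v) Hv))
        as (d & Hd & Hvd).
      exists d. split; [exact Hd |]. intros t Ht.
      assert (E : (v + RtoC t)%C = RtoC (Re v + t)).
      { destruct v as [v1 v2]. simpl in Ev. subst v2.
        unfold RtoC, Cplus; simpl. f_equal; ring. }
      assert (Hvt : ~ D (v + RtoC t)%C).
      { apply Hvd. replace (v + RtoC t - v)%C with (RtoC t) by ring. now rewrite Cmod_R. }
      rewrite E in *. apply Hreal. unfold D in Hvt; tauto.
  - intros v Hv. destruct Rlt_dec; [lra | reflexivity]. }
assert (Hup : forall w, ~ D w -> 0 < Im w -> f w = Cconj (f (Cconj w))).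
{ intros w Hw Hi. specialize (Hpos w Hw Hi). unfold h in Hpos.
  rewrite <- (Cplus_0_r (Cconj _)), <- Hpos. ring. }
intros H1 H2. destruct (Rtotal_order (Im z) 0) as [L|[E|L]].
(* The lower half plane follows from the upper one applied at [Cconj z]. *)
- rewrite (Hup (Cconj z)); rewrite ?Cconj_conj; trivial.
  + unfold D. rewrite Cconj_conj. tauto.
  + rewrite im_conj. lra.
- assert (Ez : Cconj z = z).
  { destruct z as [x y]. simpl in E. subst y. unfold Cconj; simpl. now rewrite Ropp_0. }
  assert (Er : z = RtoC (Re z)).
  { destruct z as [x y]. simpl in E. now subst y. }
  rewrite Ez. rewrite Er in H1 |- *. destruct (f_real _ H1) as [y ->].
  unfold Cconj, RtoC; simpl. now rewrite Ropp_0.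
- rewrite (Hup z), Cconj_conj; trivial. unfold D; tauto.
Qed.

(** * Symmetry of the set of poles *)

(** No point of the plane is isolated. This lets properties holding near [z] be realised together at
    one point. *)
Lemma locally'_C_ex (z : C) (Q : C -> Prop) : locally' z Q -> exists w, Q w.
Proof.
intros (d & Hd & H)%(locally_Cmod z (fun w => w <> z -> Q w)).
assert (E : (z + RtoC (d / 2) - z)%C = RtoC (d / 2)) by ring.
exists (z + RtoC (d / 2))%C. apply H.
- rewrite E, Cmod_R, Rabs_pos_eq; lra.
- intros N. rewrite N in E. assert (K := f_equal fst E). simpl in K. lra.
Qed.

Theorem theorem6p3 (f : C -> C) (P : C -> Prop)
  (f_mero : meromorphic f P)
  (f_real : forall x : R, ~ P (RtoC x) -> exists y : R, f (RtoC x) = RtoC y) :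
  forall z : C, ~ P z -> ~ P (Cconj z) /\ f (Cconj z) = Cconj (f z).
Proof.
intros z Hz.
assert (Hz' : ~ P (Cconj z)).
{ intros Hp. destruct (mero_pole _ _ f_mero _ Hp) as [_ Hlim].
  (* The threshold is the bound on [Cmod (f w)] that continuity at [z] gives below. *)
  assert (Hinf : locally' (Cconj z) (fun w => Cmod (f z) + 1 < Cmod (f w))).
  { apply (Hlim (fun t => Cmod (f z) + 1 < t)). now exists (Cmod (f z) + 1). }
  apply locally'_conj in Hinf.
  destruct (C_differentiable_continuous f z 1 (mero_holomorphic _ _ f_mero _ Hz) Rlt_0_1)
    as (d & Hd & Hc).
  assert (Hnear : locally' z (fun w => Cmod (f w - f z) < 1)).
  { apply filter_le_within, (locally_Cmod_intro z d); assumption. }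
  assert (HP := mero_discrete _ _ f_mero z).
  assert (HP' := locally'_conj z _ (mero_discrete _ _ f_mero (Cconj z))).
  (* At this [w], reflection turns the large value at [Cconj w] into a large value at [w], against
     continuity at [z]. *)
  destruct (locally'_C_ex z _ (filter_and _ _ (filter_and _ _ Hinf Hnear)
    (filter_and _ _ HP HP'))) as (w & (H1 & H2) & H3 & H4).
  rewrite (conj_symmetric_off_poles f P f_mero f_real w H3 H4), Cmod_conj in H1.
  assert (T := Cmod_triangle (f w - f z) (f z)).
  replace (f w - f z + f z)%C with (f w) in T by ring. lra. }
split; [exact Hz' |]. now apply (conj_symmetric_off_poles f P).
Qed.
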